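(* Let $a,b$ be nonzero real numbers, let $\mathcal{F}_n(a,b,x)$ be the bi-periodic Fibonacci matrix polynomials, let $\mathcal{A}_{n}(a,b,x)=\sqrt{x}\,a^{\varepsilon(n)/2}b^{(1-\varepsilon(n))/2}\mathcal{F}_{n}(a,b,x)$, let $k=x\sqrt{ab}$, and let $f_n(a,b,x)=\sum_{i=0}^{n}\binom{n}{i}k^{n-i}\mathcal{A}_i(a,b,x)$ be the falling $k$-binomial transform ($n\ge 0$). Then for every integer $n\ge 1$, $$f_{n+1}(a,b,x)=3x\sqrt{ab}\,f_{n}(a,b,x)-(2abx^{2}-1)\,f_{n-1}(a,b,x),$$ where $f_{0}(a,b,x)=\sqrt{bx}\,\mathcal{F}_{0}(a,b,x)$ and $f_{1}(a,b,x)=bx\sqrt{ax}\,\mathcal{F}_{0}(a,b,x)+\sqrt{ax}\,\mathcal{F}_{1}(a,b,x)$.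
   Context: Here $\varepsilon(n)=n-2\lfloor n/2\rfloor$ and $x$ is an indeterminate over $\mathbb{R}$; everything takes place in an algebraic closure of $\mathbb{R}(x)$, in which square roots $\sqrt a,\sqrt b,\sqrt x$ are fixed once and for all, with $\sqrt{ab}=\sqrt a\sqrt b$, $\sqrt{ax}=\sqrt a\sqrt x$, $\sqrt{bx}=\sqrt b\sqrt x$, and half-integer powers of $a$ and $b$ are taken with respect to $\sqrt a,\sqrt b$. The bi-periodic Fibonacci matrix polynomials are the $2\times 2$ matrices defined by $\mathcal{F}_0(a,b,x)=\begin{pmatrix}1&0\\0&1\end{pmatrix}$, $\mathcal{F}_1(a,b,x)=\begin{pmatrix}bx&\frac{b}{a}\\1&0\end{pmatrix}$ and, for $n\ge 2$, $\mathcal{F}_n=ax\,\mathcal{F}_{n-1}+\mathcal{F}_{n-2}$ if $n$ is even, $\mathcal{F}_n=bx\,\mathcal{F}_{n-1}+\mathcal{F}_{n-2}$ if $n$ is odd. *)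

(* Defs.v *)
From mathcomp Require Import all_boot all_order all_algebra.
From mathcomp Require Import reals.

Set Implicit Arguments.
Unset Strict Implicit.
Unset Printing Implicit Defensive.

Import GRing.Theory.

Local Open Scope ring_scope.

Definition epsn (n : nat) : nat := (n - 2 * (n %/ 2))%N.

Definition mx22 (T : nzRingType) (p q r s : T) : 'M[T]_2 :=
  \matrix_(i < 2, j < 2)
    if i == 0 then (if j == 0 then p else q) else (if j == 0 then r else s).

Fixpoint bpFibMx (R : realType) (a b : R) (n : nat) : 'M[{poly R}]_2 :=
  match n with
  | 0 => mx22 1 0
              0 1
  | n1.+1 =>
    match n1 with
    | 0 => mx22 (b%:P * 'X) (b / a)%:P
                1           0
    | n2.+1 => ((if odd n then b else a)%:P * 'X) *: bpFibMx a b n1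
               + bpFibMx a b n2
    end
  end.

(* K is an algebraic closure of R(x) through iota: it is algebraically closed
   by its type, and algebraic over the image of iota. *)
Definition algebraic_closure_of (F : fieldType) (K : closedFieldType)
    (iota : {rmorphism F -> K}) : Prop :=
  forall z : K, algebraicOver iota z.

Section InClosure.

Variables (R : realType) (K : closedFieldType).
Variable iota : {rmorphism {fraction {poly R}} -> K}.

Definition polyK (p : {poly R}) : K := iota (FracField.tofrac p).

Definition bpFibMxK (a b : R) (n : nat) : 'M[K]_2 :=
  map_mx polyK (bpFibMx a b n).

(* sa, sb, sx are the chosen square roots of a, b, x; the half-integer powers
   a^(m/2) and b^(m/2) are sa ^+ m and sb ^+ m. *)
Definition bpA (a b : R) (sa sb sx : K) (n : nat) : 'M[K]_2 :=
  (sx * sa ^+ epsn n * sb ^+ (1 - epsn n)) *: bpFibMxK a b n.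

(* sqrt(ab) is sa * sb. *)
Definition bpk (sa sb : K) : K := polyK 'X * (sa * sb).

Definition falling_binomial_transform (k : K) (A : nat -> 'M[K]_2) (n : nat) :
    'M[K]_2 :=
  \sum_(0 <= i < n.+1) ('C(n, i)%:R * k ^+ (n - i)) *: A i.

Definition bpf (a b : R) (sa sb sx : K) (n : nat) : 'M[K]_2 :=
  falling_binomial_transform (bpk sa sb) (bpA a b sa sb sx) n.

End InClosure.

(* Main.v *)
Require Import Defs.
From HB Require Import structures.
From mathcomp Require Import all_boot all_order all_algebra.
From mathcomp Require Import reals ring.

(** The normalisation by [sqrt x], [sqrt a] and [sqrt b] removes the period-two
    alternation of the recurrence: with [k = x * sqrt (a * b)], the matrices
    [A n] satisfy the constant-coefficient recurrence
    [A n.+2 = k A n.+1 + A n] ([bpA_rec]).  Write [E] for the shift operator on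
    sequences.  Pascal's rule says that the falling binomial transform of [A] at
    [n] is [(k + E)^n A] at [0] ([falling_binomial_transformS]).  On solutions
    of the recurrence [E^2 = k E + 1], so [S = k + E] satisfies
    [S^2 = 3 k S - (2 k^2 - 1)] ([falling_binomial_transform_rec]).  The theorem
    follows by substituting [k^2 = a b x^2]. *)

Import GRing.Theory.

Local Open Scope ring_scope.

HB.instance Definition _ (R : realType) (K : closedFieldType)
    (iota : {rmorphism {fraction {poly R}} -> K}) :=
  GRing.RMorphism.copy (polyK iota) (iota \o @FracField.tofrac {poly R}).

(** Operator form: if [E] is the shift, the transform at [n.+1] is the transform
    at [n] of [(k + E) A]. *)
Lemma falling_binomial_transformS (K : closedFieldType) (k : K)
    (A : nat -> 'M[K]_2) (n : nat) :
  falling_binomial_transform k A n.+1 =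
  k *: falling_binomial_transform k A n
  + falling_binomial_transform k (fun i => A i.+1) n.
Proof.
(* The sum on the left of Pascal's rule is extended to the index n.+1, where
   its binomial coefficient vanishes. *)
have -> : k *: falling_binomial_transform k A n =
    \sum_(0 <= i < n.+2) ('C(n, i)%:R * k ^+ (n.+1 - i)) *: A i.
  rewrite [RHS]big_nat_recr //= bin_small // mul0r scale0r addr0.
  rewrite /falling_binomial_transform scaler_sumr.
  apply: eq_big_nat => i /andP[_ i_le_n].
  by rewrite scalerA subSn // exprS mulrCA.
rewrite /falling_binomial_transform.
rewrite big_nat_recl // [in RHS]big_nat_recl // !bin0 -addrA -big_split /=.
congr (_ + _); apply: eq_bigr => i _.
by rewrite binS natrD mulrDl scalerDl subSS.
Qed.

(** The polynomial [t^2 - k t - 1] annihilating the shift [E] becomes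
    [t^2 - 3 k t + (2 k^2 - 1)] for [k + E]. *)
Lemma falling_binomial_transform_rec (K : closedFieldType) (k : K)
    (A : nat -> 'M[K]_2) (n : nat)
    (A_rec : forall i, A i.+2 = k *: A i.+1 + A i) :
  falling_binomial_transform k A n.+2 =
  (3%:R * k) *: falling_binomial_transform k A n.+1
  - (2%:R * k ^+ 2 - 1) *: falling_binomial_transform k A n.
Proof.
have shift2 : falling_binomial_transform k (fun i => A i.+2) n =
    k *: falling_binomial_transform k (fun i => A i.+1) n
    + falling_binomial_transform k A n.
  rewrite /falling_binomial_transform scaler_sumr -big_split /=.
  by apply: eq_bigr => i _; rewrite A_rec scalerDr !scalerA [k * _]mulrC.
rewrite !falling_binomial_transformS shift2.
by apply/matrixP => i j; rewrite !mxE; ring.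
Qed.

Lemma epsn_odd (n : nat) : epsn n = odd n.
Proof. by rewrite /epsn mulnC {1}(divn_eq n 2) addKn modn2. Qed.

Lemma bpFibMxSS (R : realType) (a b : R) (n : nat) :
  bpFibMx a b n.+2 =
  ((if odd n then b else a)%:P * 'X) *: bpFibMx a b n.+1 + bpFibMx a b n.
Proof. by rewrite /= negbK. Qed.

(** Going from [n.+1] to [n.+2] exchanges the factors [sqrt a] and [sqrt b] of
    the normalisation; together with the coefficient [a x] or [b x] of the
    recurrence this gives [x * sqrt (a * b)] for either parity. *)
Lemma bpA_rec (R : realType) (K : closedFieldType)
    (iota : {rmorphism {fraction {poly R}} -> K}) (a b : R) (sa sb sx : K)
    (sa2 : sa ^+ 2 = polyK iota a%:P) (sb2 : sb ^+ 2 = polyK iota b%:P)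
    (n : nat) :
  bpA iota a b sa sb sx n.+2 =
  bpk iota sa sb *: bpA iota a b sa sb sx n.+1 + bpA iota a b sa sb sx n.
Proof.
rewrite /bpA /bpk /bpFibMxK bpFibMxSS map_mxD map_mxZ rmorphM /= !epsn_odd /=.
case: (odd n); rewrite /= -?sa2 -?sb2;
  by apply/matrixP => i j; rewrite !mxE; ring.
Qed.

(* sqrt(ab), sqrt(ax), sqrt(bx) are sa * sb, sa * sx, sb * sx. *)
Theorem theorem3p8 (R : realType) (K : closedFieldType)
    (iota : {rmorphism {fraction {poly R}} -> K})
    (iota_closure : algebraic_closure_of iota)
    (a b : R) (a_neq0 : a != 0) (b_neq0 : b != 0)
    (sa sb sx : K)
    (sa2 : sa ^+ 2 = polyK iota a%:P)
    (sb2 : sb ^+ 2 = polyK iota b%:P)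
    (sx2 : sx ^+ 2 = polyK iota 'X) :
  let x := polyK iota 'X in
  let F := bpFibMxK iota a b in
  let f := bpf iota a b sa sb sx in
  [/\ forall n : nat, (1 <= n)%N ->
        f n.+1 = (3%:R * x * (sa * sb)) *: f n
                 - polyK iota ((2%:R * a * b)%:P * 'X ^+ 2 - 1) *: f n.-1,
      f 0%N = (sb * sx) *: F 0%N
    & f 1%N = (polyK iota (b%:P * 'X) * (sa * sx)) *: F 0%N
              + (sa * sx) *: F 1%N].
Proof.
move=> x F f.
have f0 : f 0%N = bpA iota a b sa sb sx 0.
  by rewrite /f /bpf /falling_binomial_transform big_nat1 bin0 mulr1 scale1r.
have A0 : bpA iota a b sa sb sx 0 = (sb * sx) *: F 0%N.
  by rewrite /bpA epsn_odd expr0 mulr1 expr1 mulrC.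
have A1 : bpA iota a b sa sb sx 1 = (sa * sx) *: F 1%N.
  by rewrite /bpA epsn_odd expr0 mulr1 expr1 mulrC.
split; last 2 first.
- by rewrite f0.
- rewrite /f /bpf falling_binomial_transformS.
  rewrite -[falling_binomial_transform _ _ 0]/(f 0%N) f0 A0.
  rewrite /falling_binomial_transform big_nat1 bin0 mulr1 scale1r A1.
  rewrite scalerA rmorphM /= -sb2 /bpk; congr (_ *: _ + _).
  by ring.
move=> [//|n] _.
rewrite /f /bpf falling_binomial_transform_rec; last exact: bpA_rec.
congr (_ *: _ - _ *: _); first by rewrite /bpk mulrA.
rewrite /bpk rmorphB rmorphM rmorph1 rmorphXn /= !polyCM !rmorphM /=.
rewrite polyC_natr rmorph_nat -sa2 -sb2.
by ring.
Qed.
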